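(* Let $p\in\mathbb H$, $R>0$, and let $f$ be a left slice hyperholomorphic function in an axially symmetric open neighbourhood of $p$ containing the Cassini ball $U(p,R)$, admitting there the spherical expansion $$f(q)=\sum_{n=0}^\infty Q_p^n(q)\,[a_{2n}+(q-p)a_{2n+1}],\qquad\{a_n\}_{n\in\mathbb N_0}\subseteq\mathbb H,$$ converging absolutely and uniformly on the compact subsets of $U(p,R)$. Then $\breve f=\Delta f$ has, for $q\in U(p,R)$, the expansion $$\breve f(q)=\Delta f(q)=-16(q_0-p_0)^2\sum_{n=0}^\infty\mathcal C_{n+2}(q,p)[a_{2n+4}+(q-p)a_{2n+5}]-8(q_0-p_0)\sum_{n=0}^\infty\mathcal L_{n+1}(q,p)a_{2n+3}-4\sum_{n=0}^\infty(n+1)Q_p^n(q)[a_{2n+2}+(q-p)a_{2n+3}].$$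
   Context: $\mathbb H$ denotes the quaternions $q=q_0+q_1e_1+q_2e_2+q_3e_3$ with the usual relations, $\underline q=q_1e_1+q_2e_2+q_3e_3$, $\bar q=q_0-\underline q$, $\mathbb S=\{\underline q:|\underline q|=1\}$, $[q]=\{q_0+I|\underline q|:I\in\mathbb S\}$; a set $U$ is axially symmetric if $[q]\subset U$ for all $q\in U$. Slice hyperholomorphic: for $U$ axially symmetric open and $\mathcal U=\{(u,v)\in\mathbb R^2:u+\mathbb Sv\subset U\}$, $f:U\to\mathbb H$ is left slice hyperholomorphic if $f(u+Iv)=\alpha(u,v)+I\beta(u,v)$ for all $(u,v)\in\mathcal U$, $I\in\mathbb S$, with $C^1$ functions $\alpha,\beta:\mathcal U\to\mathbb H$, $\alpha$ even and $\beta$ odd in $v$, satisfying $\partial_u\alpha=\partial_v\beta$, $\partial_v\alpha=-\partial_u\beta$. $\Delta=\sum_{i=0}^3\partial_{q_i}^2$ in the variable $q$. $p_0=\mathrm{Re}(p)$; $Q_p(q)=q^2-2p_0q+|p|^2$, $Q_p^n(q)=(Q_p(q))^n$. The Cassini ball is $U(p,R)=\{q\in\mathbb H:|Q_p(q)|<R^2\}$. $$\mathcal L_n(q,p)=\sum_{k=0}^{n-1}\overline{Q_p^{\,n-1-k}(q)}\,Q_p^k(q)\ (n\ge1),\qquad\mathcal C_n(q,p)=\sum_{k=0}^{n-2}(k+1)\,\overline{Q_p^{\,n-2-k}(q)}\,Q_p^k(q)\ (n\ge2).$$ *)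

(* Defs.v *)
From Stdlib Require Import Reals List.
From Coquelicot Require Import Coquelicot.
Open Scope R_scope.

(** [(q0, q1, q2, q3)] stands for q0 + q1 e1 + q2 e2 + q3 e3.  The real
    normed space structure is the one of the product R^4, whose norm in
    Coquelicot is the Euclidean one, see [norm_quat]. *)

Definition quat : Type := (R * R * R * R)%type.

Definition re (q : quat) : R := fst (fst (fst q)).
Definition im1 (q : quat) : R := snd (fst (fst q)).
Definition im2 (q : quat) : R := snd (fst q).
Definition im3 (q : quat) : R := snd q.

Definition R4_NormedModule : NormedModule R_AbsRing :=
  prod_NormedModule R_AbsRing
    (prod_NormedModule R_AbsRing
      (prod_NormedModule R_AbsRing R_NormedModule R_NormedModule)
      R_NormedModule)
    R_NormedModule.

Canonical quat_AbelianMonoid :=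
  AbelianMonoid.Pack quat (AbelianMonoid.class R4_NormedModule) quat.
Canonical quat_AbelianGroup :=
  AbelianGroup.Pack quat (AbelianGroup.class R4_NormedModule) quat.
Canonical quat_UniformSpace :=
  UniformSpace.Pack quat (UniformSpace.class R4_NormedModule) quat.
Canonical quat_ModuleSpace :=
  ModuleSpace.Pack R_Ring quat (ModuleSpace.class R_Ring R4_NormedModule) quat.
Canonical quat_NormedModuleAux :=
  NormedModuleAux.Pack R_AbsRing quat
    (NormedModuleAux.class R_AbsRing R4_NormedModule) quat.
Canonical quat_NormedModule :=
  NormedModule.Pack R_AbsRing quat
    (NormedModule.class R_AbsRing R4_NormedModule) quat.

Lemma norm_quat (q : quat) :
  norm q = sqrt (re q ^ 2 + im1 q ^ 2 + im2 q ^ 2 + im3 q ^ 2).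
Proof.
destruct q as [[[a b] c] d].
change (norm (((a, b), c), d)) with
  (sqrt (sqrt (sqrt (Rabs a ^ 2 + Rabs b ^ 2) ^ 2 + Rabs c ^ 2) ^ 2
         + Rabs d ^ 2)).
unfold re, im1, im2, im3; simpl fst; simpl snd.
rewrite <- !Rsqr_pow2, <- !Rsqr_abs, !Rsqr_pow2.
rewrite 2!pow2_sqrt.
- reflexivity.
- apply Rplus_le_le_0_compat; apply pow2_ge_0.
- rewrite pow2_sqrt; repeat apply Rplus_le_le_0_compat; apply pow2_ge_0.
Qed.

Definition quat_mult (x y : quat) : quat :=
  (re x * re y - im1 x * im1 y - im2 x * im2 y - im3 x * im3 y,
   re x * im1 y + im1 x * re y + im2 x * im3 y - im3 x * im2 y,
   re x * im2 y - im1 x * im3 y + im2 x * re y + im3 x * im1 y,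
   re x * im3 y + im1 x * im2 y - im2 x * im1 y + im3 x * re y).

Definition e0 : quat := (1, 0, 0, 0).
Definition e1 : quat := (0, 1, 0, 0).
Definition e2 : quat := (0, 0, 1, 0).
Definition e3 : quat := (0, 0, 0, 1).

Lemma quat_ext (x y : quat) :
  re x = re y -> im1 x = im1 y -> im2 x = im2 y -> im3 x = im3 y -> x = y.
Proof.
destruct x as [[[? ?] ?] ?], y as [[[? ?] ?] ?]; unfold re, im1, im2, im3.
simpl; intros; subst; reflexivity.
Qed.

Definition quat_Ring_mixin : Ring.mixin_of quat_AbelianGroup.
Proof.
exists quat_mult e0; intros;
  apply quat_ext; unfold quat_mult, e0, re, im1, im2, im3, plus; simpl;
  unfold plus; simpl; ring.
Defined.

Canonical quat_Ring :=
  Ring.Pack quat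
    (Ring.Class quat (AbelianGroup.class quat_AbelianGroup) quat_Ring_mixin)
    quat.

Definition RtoH (c : R) : quat := (c, 0, 0, 0).
Definition conj (q : quat) : quat := (re q, - im1 q, - im2 q, - im3 q).
Definition vec (q : quat) : quat := (0, im1 q, im2 q, im3 q).

Declare Scope quat_scope.
Delimit Scope quat_scope with quat.
Bind Scope quat_scope with quat.
Reserved Notation "c *: q" (at level 40, left associativity).
Notation "x + y" := (plus x y) : quat_scope.
Notation "x - y" := (minus x y) : quat_scope.
Notation "- x" := (opp x) : quat_scope.
Notation "x * y" := (mult x y) : quat_scope.
Notation "x ^ n" := (pow_n x n) : quat_scope.
Notation "c *: q" := (scal c%R q%quat) : quat_scope.

Definition unit_im (I : quat) : Prop := re I = 0 /\ norm I = 1.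

Definition sphere (q x : quat) : Prop :=
  exists I : quat, unit_im I /\ x = (RtoH (re q) + norm (vec q) *: I)%quat.

Definition axially_symmetric (U : quat -> Prop) : Prop :=
  forall q, U q -> forall x, sphere q x -> U x.

Definition plane_domain (U : quat -> Prop) (z : R * R) : Prop :=
  forall I, unit_im I -> U (RtoH (fst z) + snd z *: I)%quat.

Definition C1_partials (D : R * R -> Prop) (g gu gv : R * R -> quat) : Prop :=
  forall u v, D (u, v) ->
    is_derive (fun x => g (x, v)) u (gu (u, v)) /\
    is_derive (fun y => g (u, y)) v (gv (u, v)) /\
    continuous gu (u, v) /\ continuous gv (u, v).

(** Only the values of [f] on [U], and those of [alpha] and [beta] on
    [plane_domain U], are relevant. *)
Definition left_slice_hyperholomorphic (U : quat -> Prop) (f : quat -> quat) :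
    Prop :=
  exists alpha beta alpha_u alpha_v beta_u beta_v : R * R -> quat,
    C1_partials (plane_domain U) alpha alpha_u alpha_v /\
    C1_partials (plane_domain U) beta beta_u beta_v /\
    (forall u v, plane_domain U (u, v) ->
       alpha (u, (- v)%R) = alpha (u, v) /\
       beta (u, (- v)%R) = (- beta (u, v))%quat /\
       alpha_u (u, v) = beta_v (u, v) /\
       alpha_v (u, v) = (- beta_u (u, v))%quat /\
       forall I, unit_im I ->
         f (RtoH u + v *: I)%quat = (alpha (u, v) + I * beta (u, v))%quat).

Definition is_pderiv (e : quat) (f : quat -> quat) (q d : quat) : Prop :=
  is_derive (fun t : R => f (q + t *: e)%quat) 0 d.

Definition is_pderiv2 (e : quat) (f : quat -> quat) (q d : quat) : Prop :=
  exists g : quat -> quat,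
    locally q (fun x => is_pderiv e f x (g x)) /\ is_pderiv e g q d.

Definition is_laplacian (f : quat -> quat) (q l : quat) : Prop :=
  exists d0 d1 d2 d3 : quat,
    is_pderiv2 e0 f q d0 /\ is_pderiv2 e1 f q d1 /\
    is_pderiv2 e2 f q d2 /\ is_pderiv2 e3 f q d3 /\
    l = (d0 + d1 + d2 + d3)%quat.

Definition Qp (p q : quat) : quat :=
  (q ^ 2 - (2 * re p) *: q + RtoH (norm p ^ 2))%quat.

Definition cassini_ball (p : quat) (r : R) (q : quat) : Prop :=
  norm (Qp p q) < r ^ 2.

(** [sum_n u m] is u 0 + ... + u m, both ends included: [cal_L n] is meant for
    n >= 1 and [cal_C n] for n >= 2. *)
Definition cal_L (n : nat) (q p : quat) : quat :=
  sum_n (fun k => conj (Qp p q ^ (n - 1 - k)) * Qp p q ^ k)%quat (n - 1).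

Definition cal_C (n : nat) (q p : quat) : quat :=
  sum_n (fun k => INR (k + 1) *:
                  (conj (Qp p q ^ (n - 2 - k)) * Qp p q ^ k))%quat (n - 2).

Definition spherical_term (a : nat -> quat) (p q : quat) (n : nat) : quat :=
  (Qp p q ^ n * (a (2 * n)%nat + (q - p) * a (2 * n + 1)%nat))%quat.

Definition compact_set {T : UniformSpace} (K : T -> Prop) : Prop :=
  forall (J : Type) (O : J -> T -> Prop),
    (forall j, open (O j)) ->
    (forall x, K x -> exists j, O j x) ->
    exists l : list J, forall x, K x -> exists j, In j l /\ O j x.

Definition expansion_on (U : quat -> Prop) (f : quat -> quat)
    (u : quat -> nat -> quat) : Prop :=
  (forall q, U q -> ex_series (fun n => norm (u q n))) /\
  (forall K : quat -> Prop, compact_set K -> (forall q, K q -> U q) ->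
     forall eps : posreal,
       eventually (fun n => forall q, K q ->
         norm (sum_n (u q) n - f q)%quat < eps)).

(* Main.v *)
Require Import Defs.
From Stdlib Require Import Reals List Lra Lia.
From Coquelicot Require Import Coquelicot.
Open Scope R_scope.

(* Put y = q - p0, so that Qp p q = y^2 + c with c real.  Along a line q + t e
   the map Qp is quadratic in t, hence the first two derivatives of its powers
   obey linear recurrences, and so do the Taylor remainders, which are bounded by
   t^2 n^3 L^3 rho^n as soon as |Qp| <= rho.  The hypothesis on the series forces
   sum s^n (|a_2n| + |a_2n+1|) to converge for every s < r^2; choosing
   |Qp p q| < rho < s < r^2, the series may be differentiated twice term by term.
   For a single term one finds by induction
     sum_i e_i d_i Qp^n = sum_i (d_i Qp^n) e_i = -4 y0 L_n,
     Laplacian (Qp^n) = -16 y0^2 C_n - 4 n Qp^(n-1),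
   and the second order Leibniz rule for Qp^n (a_2n + (q - p) a_2n+1)
   gives the formula. *)

(** * Quaternion arithmetic and norms *)

(** [Qp] commutes with y but in general not with the direction of differentiation, so the derivative
    of Qp^n is not n Qp^(n-1) times the velocity. It is generated by Leibniz recurrences, and closed
    forms appear only after summing over the four directions. Behind them is the identity sum_i e_i
    x e_i = -2 conj(x), which brings the conjugates of [cal_L] and [cal_C] into the formula. Both
    one-sided sums are needed: the left one drives the induction for the Laplacian of Qp^n, the
    right one evaluates the cross terms of the Leibniz rule, where e_i a_(2n+1) stands to the right
    of d_i Qp^n. The analytic difficulty is uniformity in n. With velocity at most L rho and
    acceleration at most 2 L^2 rho, every bound has the shape n^k L^k rho^n, which survives
    multiplication by [Qp] and makes no use of its inverse. The exponent k = 3 comes from the Taylor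
    remainder of the first derivative. *)

Ltac quat_ring :=
  intros;
  repeat match goal with
  | x : ?T |- _ => unify T quat; change quat in x; destruct x as [[[? ?] ?] ?]
  end;
  apply quat_ext; cbn -[IZR]; field.

Lemma norm_quat_mult (x y : quat) : norm (x * y)%quat = norm x * norm y.
Proof.
rewrite !norm_quat, <- sqrt_mult;
  [|repeat apply Rplus_le_le_0_compat; apply pow2_ge_0
   |repeat apply Rplus_le_le_0_compat; apply pow2_ge_0].
f_equal; destruct x as [[[? ?] ?] ?], y as [[[? ?] ?] ?]; cbn -[pow]; ring.
Qed.

Lemma norm_quat_scal (c : R) (x : quat) : norm (c *: x)%quat = Rabs c * norm x.
Proof.
rewrite !norm_quat, <- sqrt_Rsqr_abs, <- sqrt_mult;
  [|apply Rle_0_sqr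
   |repeat apply Rplus_le_le_0_compat; apply pow2_ge_0].
f_equal; destruct x as [[[? ?] ?] ?]; cbn -[pow]; unfold Rsqr; ring.
Qed.

Lemma norm_conj (x : quat) : norm (conj x) = norm x.
Proof.
rewrite !norm_quat; f_equal; unfold conj; cbn [re im1 im2 im3 fst snd]; ring.
Qed.

Lemma norm_quat_opp (x : quat) : norm (- x)%quat = norm x.
Proof. exact (norm_opp x). Qed.

Lemma norm_zero_quat : norm (zero : quat) = 0.
Proof. exact (norm_zero (V := quat_NormedModule)). Qed.

Lemma norm_one_quat : norm (one : quat) = 1.
Proof. rewrite norm_quat, <- sqrt_1; f_equal; cbn; ring. Qed.

Lemma norm_pow_quat (x : quat) (n : nat) : norm (x ^ n)%quat = norm x ^ n.
Proof.
induction n as [|n IH]; [exact norm_one_quat|].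
cbn -[norm]; rewrite norm_quat_mult, IH; reflexivity.
Qed.

Lemma components_le_norm (x : quat) :
  Rabs (re x) <= norm x /\ Rabs (im1 x) <= norm x /\
  Rabs (im2 x) <= norm x /\ Rabs (im3 x) <= norm x.
Proof.
rewrite norm_quat, <- !sqrt_Rsqr_abs; unfold Rsqr.
repeat split; apply sqrt_le_1_alt;
  generalize (pow2_ge_0 (re x)), (pow2_ge_0 (im1 x)), (pow2_ge_0 (im2 x)),
    (pow2_ge_0 (im3 x)); lra.
Qed.

Lemma norm_le_components (x : quat) :
  norm x <= Rabs (re x) + Rabs (im1 x) + Rabs (im2 x) + Rabs (im3 x).
Proof.
generalize (Rabs_pos (re x)), (Rabs_pos (im1 x)), (Rabs_pos (im2 x)),
  (Rabs_pos (im3 x)); intros.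
rewrite norm_quat.
match goal with |- _ <= ?s => rewrite <- (sqrt_Rsqr s) by lra end.
apply sqrt_le_1_alt; rewrite <- (pow2_abs (re x)), <- (pow2_abs (im1 x)),
  <- (pow2_abs (im2 x)), <- (pow2_abs (im3 x)); unfold Rsqr; nra.
Qed.

(** * Jets of powers along quadratic curves *)

Ltac nonneg :=
  repeat first [assumption | apply pow2_ge_0 | apply pos_INR
               | apply pow_le | apply Rmult_le_pos].

Fixpoint pow_d1 (Q A : quat) (n : nat) : quat :=
  match n with
  | O => zero
  | S m => (A * Q ^ m + Q * pow_d1 Q A m)%quat
  end.

Fixpoint pow_d2 (Q A B : quat) (n : nat) : quat :=
  match n with
  | O => zero
  | S m => (B * Q ^ m + 2 *: (A * pow_d1 Q A m) + Q * pow_d2 Q A B m)%quat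
  end.

Lemma norm_mult_le (x y : quat) (a b : R) :
  norm x <= a -> norm y <= b -> norm (x * y)%quat <= a * b.
Proof.
intros Hx Hy; rewrite norm_quat_mult.
apply Rmult_le_compat; trivial; apply norm_ge_0.
Qed.

Lemma norm_plus_le (x y : quat) (a b : R) :
  norm x <= a -> norm y <= b -> norm (x + y)%quat <= a + b.
Proof.
intros Hx Hy; apply Rle_trans with (norm x + norm y); [apply norm_triangle|lra].
Qed.

Lemma norm_scal_le (c : R) (x : quat) (b a : R) :
  Rabs c <= b -> norm x <= a -> norm (c *: x)%quat <= b * a.
Proof.
intros Hc Hx; rewrite norm_quat_scal.
apply Rmult_le_compat; trivial; [apply Rabs_pos|apply norm_ge_0].
Qed.

Lemma norm_pow_le (Q : quat) (rho : R) (n : nat) :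
  norm Q <= rho -> norm (Q ^ n)%quat <= rho ^ n.
Proof.
intros HQ; rewrite norm_pow_quat; apply pow_incr; split; trivial; apply norm_ge_0.
Qed.

(** Writing the velocity bound as a multiple of [rho] turns n |A| rho^(n-1) into n L rho^n, one
    shape for all n including 0. *)
Lemma norm_pow_d1_le (Q A : quat) (rho L : R) (n : nat) :
  norm Q <= rho -> norm A <= L * rho ->
  norm (pow_d1 Q A n) <= INR n * L * rho ^ n.
Proof.
intros HQ HA; induction n as [|n IH].
- simpl pow_d1; simpl pow_d2; rewrite norm_zero_quat; simpl; lra.
- rewrite S_INR; cbn -[norm pow INR].
  eapply Rle_trans; [apply norm_plus_le|].
  + apply norm_mult_le; [exact HA|apply norm_pow_le, HQ].
  + apply norm_mult_le; [exact HQ|exact IH].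
  + right; cbn [pow]; ring.
Qed.

(** The factor 2 n^2 absorbs n (n - 1) ordered pairs of velocities and n accelerations, the latter
    worth 2 L^2 each. *)
Lemma norm_pow_d2_le (Q A B : quat) (rho L : R) (n : nat) :
  0 <= L * rho ->
  norm Q <= rho -> norm A <= L * rho -> norm B <= 2 * L ^ 2 * rho ->
  norm (pow_d2 Q A B n) <= 2 * INR n ^ 2 * L ^ 2 * rho ^ n.
Proof.
intros HL HQ HA HB.
assert (H0 : 0 <= rho) by (eapply Rle_trans; [apply (norm_ge_0 Q)|exact HQ]).
induction n as [|n IH].
- simpl pow_d1; simpl pow_d2; rewrite norm_zero_quat; simpl; lra.
- rewrite S_INR; cbn -[norm pow INR].
  eapply Rle_trans; [apply norm_plus_le; [apply norm_plus_le|]|].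
  + apply norm_mult_le; [exact HB|apply norm_pow_le, HQ].
  + apply norm_scal_le; [rewrite Rabs_pos_eq by lra; apply Rle_refl|].
    apply norm_mult_le; [exact HA|apply norm_pow_d1_le; eassumption].
  + apply norm_mult_le; [exact HQ|exact IH].
  + generalize (pos_INR n) (pow_le rho n H0) (pow2_ge_0 L); intros.
    assert (0 <= rho * L ^ 2 * rho ^ n * INR n) by nonneg.
    cbn [pow] in *; nra.
Qed.

(* Here and below, [Q], [A] and [Q'], [A'] are position and velocity of a quadratic
   curve at times [0] and [t], and [B] is its constant acceleration. *)
Lemma pow_d1_remainder (Q A B Q' A' : quat) (t rho L : R) (n : nat) :
  0 <= L * rho ->
  Q' = (Q + t *: A + (t ^ 2 / 2) *: B)%quat -> A' = (A + t *: B)%quat ->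
  norm Q <= rho -> norm Q' <= rho -> norm A <= L * rho -> norm A' <= L * rho ->
  norm B <= 2 * L ^ 2 * rho ->
  norm (Q' ^ n - Q ^ n - t *: pow_d1 Q A n)%quat
    <= t ^ 2 * (INR n ^ 2 * L ^ 2 * rho ^ n).
Proof.
intros HL HQt HAt HQ HQ' HA HA' HB.
assert (H0 : 0 <= rho) by (eapply Rle_trans; [apply (norm_ge_0 Q)|exact HQ]).
induction n as [|n IH].
- match goal with |- norm ?x <= _ =>
    replace x with (zero : quat) by (simpl; quat_ring) end.
  rewrite norm_zero_quat; simpl; lra.
- rewrite S_INR.
  (* For quadratic motion Q' - Q = t (A + A') / 2 exactly, so each new error term is t^2 times a
     bounded quantity, uniformly in t. *)
  match goal with |- norm ?x <= _ => replace x with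
    (Q' * (Q' ^ n - Q ^ n - t *: pow_d1 Q A n) + (t ^ 2 / 2) *: (B * Q ^ n)
     + (t ^ 2 / 2) *: ((A + A') * pow_d1 Q A n))%quat end.
  2: { simpl pow_d1; simpl pow_n; clear - HQt HAt.
       generalize (Q' ^ n)%quat, (Q ^ n)%quat, (pow_d1 Q A n).
       subst; clear; quat_ring. }
  assert (Ht : Rabs (t ^ 2 / 2) <= t ^ 2 / 2)
    by (rewrite Rabs_pos_eq; generalize (pow2_ge_0 t); lra).
  eapply Rle_trans; [apply norm_plus_le; [apply norm_plus_le|]|].
  + apply norm_mult_le; [exact HQ'|exact IH].
  + apply norm_scal_le; [exact Ht|].
    apply norm_mult_le; [exact HB|apply norm_pow_le, HQ].
  + apply norm_scal_le; [exact Ht|].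
    apply norm_mult_le; [apply norm_plus_le; eassumption
      |apply norm_pow_d1_le; eassumption].
  + assert (0 <= t ^ 2 * L ^ 2 * (rho * rho ^ n) * INR n).
    { nonneg. }
    simpl pow in *; nra.
Qed.

Lemma pow_d2_remainder (Q A B Q' A' : quat) (t rho L : R) (n : nat) :
  0 <= L -> 0 <= rho ->
  Q' = (Q + t *: A + (t ^ 2 / 2) *: B)%quat -> A' = (A + t *: B)%quat ->
  norm Q <= rho -> norm Q' <= rho -> norm A <= L * rho -> norm A' <= L * rho ->
  norm B <= 2 * L ^ 2 * rho ->
  norm (pow_d1 Q' A' n - pow_d1 Q A n - t *: pow_d2 Q A B n)%quat
    <= t ^ 2 * (INR n ^ 3 * L ^ 3 * rho ^ n).
Proof.
intros HL H0 HQt HAt HQ HQ' HA HA' HB.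
assert (HLr : 0 <= L * rho) by nonneg.
induction n as [|n IH].
- match goal with |- norm ?x <= _ =>
    replace x with (zero : quat) by (simpl; quat_ring) end.
  rewrite norm_zero_quat; simpl; lra.
- rewrite S_INR.
  (* The coefficient 3/2 collects 1/2 from Q' - Q and 1 from A' - A. In units of t^2 L^3 rho^(n+1)
     the four bounds are n^3, 3 n, 2 n^2 and n^2, together at most (n + 1)^3. *)
  match goal with |- norm ?x <= _ => replace x with
    (Q' * (pow_d1 Q' A' n - pow_d1 Q A n - t *: pow_d2 Q A B n)
     + (t ^ 2 * (3 / 2)) *: (B * pow_d1 Q A n)
     + (t ^ 2 / 2) *: ((A + A') * pow_d2 Q A B n)
     + A' * (Q' ^ n - Q ^ n - t *: pow_d1 Q A n))%quat end.
  2: { simpl pow_d1; simpl pow_d2; simpl pow_n; clear - HQt HAt.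
       generalize (Q' ^ n)%quat, (Q ^ n)%quat, (pow_d1 Q' A' n), (pow_d1 Q A n),
         (pow_d2 Q A B n).
       subst; clear; quat_ring. }
  assert (Ht : Rabs (t ^ 2 / 2) <= t ^ 2 / 2)
    by (rewrite Rabs_pos_eq; generalize (pow2_ge_0 t); lra).
  assert (Ht' : Rabs (t ^ 2 * (3/2)) <= t ^ 2 * (3/2))
    by (rewrite Rabs_pos_eq; generalize (pow2_ge_0 t); lra).
  eapply Rle_trans;
    [apply norm_plus_le; [apply norm_plus_le; [apply norm_plus_le|]|]|].
  + apply norm_mult_le; [exact HQ'|exact IH].
  + apply norm_scal_le; [exact Ht'|].
    apply norm_mult_le; [exact HB|apply norm_pow_d1_le; eassumption].
  + apply norm_scal_le; [exact Ht|].
    apply norm_mult_le; [apply norm_plus_le; eassumption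
      |apply norm_pow_d2_le; eassumption].
  + apply norm_mult_le; [exact HA'|eapply pow_d1_remainder; eassumption].
  + assert (Hu : 0 <= t ^ 2 * L ^ 3 * (rho * rho ^ n)).
    { nonneg. }
    assert (Hn := pos_INR n).
    assert (0 <= t ^ 2 * L ^ 3 * (rho * rho ^ n) * INR n)
      by nonneg.
    assert (0 <= t ^ 2 * L ^ 3 * (rho * rho ^ n) * INR n * INR n)
      by nonneg.
    simpl pow in *; nra.
Qed.

(** * Cauchy-Fueter and Laplace identities for powers *)

Lemma conj_pow_S (Q : quat) (n : nat) :
  conj (Q ^ S n)%quat = (conj Q * conj (Q ^ n))%quat.
Proof.
change (Q ^ S n)%quat with (Q * Q ^ n)%quat.
rewrite <- pow_n_comm_1; generalize (Q ^ n)%quat; quat_ring.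
Qed.

(* [lsum Q n] and [csum Q n] are [cal_L n] and [cal_C n] for [n >= 1], resp.
   [n >= 2], continued by [0] below, where truncated subtraction would make
   [cal_L 0], [cal_C 0] and [cal_C 1] equal to [1]. *)
Fixpoint lsum (Q : quat) (n : nat) : quat :=
  match n with
  | O => zero
  | S m => (conj Q * lsum Q m + Q ^ m)%quat
  end.

Fixpoint csum (Q : quat) (n : nat) : quat :=
  match n with
  | O => zero
  | S m => (conj Q * csum Q m + INR m *: (Q ^ pred m))%quat
  end.

Lemma cal_L_lsum (n : nat) (q p : quat) :
  cal_L (n + 1) q p = lsum (Qp p q) (n + 1).
Proof.
unfold cal_L; rewrite Nat.add_sub; generalize (Qp p q) as Q; intros Q.
rewrite Nat.add_1_r; induction n as [|n IH].
- rewrite sum_O; simpl; quat_ring.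
- rewrite sum_Sn, Nat.sub_diag.
  change (lsum Q (S (S n))) with (conj Q * lsum Q (S n) + Q ^ S n)%quat.
  rewrite <- IH, <- sum_n_mult_l; f_equal.
  + apply sum_n_ext_loc; intros k Hk.
    rewrite Nat.sub_succ_l, conj_pow_S by exact Hk.
    symmetry; apply mult_assoc.
  + generalize (Q ^ S n)%quat; simpl; quat_ring.
Qed.

Lemma cal_C_csum (n : nat) (q p : quat) :
  cal_C (n + 2) q p = csum (Qp p q) (n + 2).
Proof.
unfold cal_C; rewrite Nat.add_sub; generalize (Qp p q) as Q; intros Q.
rewrite <- plus_n_Sm, Nat.add_1_r; induction n as [|n IH].
- rewrite sum_O; simpl; quat_ring.
- rewrite sum_Sn, Nat.sub_diag.
  change (csum Q (S (S (S n)))) with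
    (conj Q * csum Q (S (S n)) + INR (S (S n)) *: (Q ^ S n))%quat.
  rewrite <- IH; f_equal.
  + etransitivity; [|exact (sum_n_mult_l (K := quat_Ring) (conj Q) _ n)].
    apply sum_n_ext_loc; intros k Hk.
    rewrite Nat.sub_succ_l, conj_pow_S by exact Hk.
    generalize (Q ^ (n - k))%quat, (Q ^ k)%quat, (INR (k + 1)); quat_ring.
  + rewrite Nat.add_1_r; generalize (Q ^ S n)%quat, (INR (S (S n))).
    simpl; quat_ring.
Qed.

(** Here the term k = 0 is split off and [Q] is factored out of the rest, whereas the definition
    splits off the highest power of [Q]. *)
Lemma lsum_succ_left (Q : quat) (n : nat) :
  lsum Q (S n) = (Q * lsum Q n + conj (Q ^ n))%quat.
Proof.
induction n as [|n IH]; [simpl; quat_ring|].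
change (lsum Q (S (S n))) with (conj Q * lsum Q (S n) + Q ^ S n)%quat.
rewrite IH at 1; simpl lsum; rewrite conj_pow_S; simpl pow_n.
generalize (lsum Q n), (Q ^ n)%quat; quat_ring.
Qed.

Lemma lsum_succ_right (Q : quat) (n : nat) :
  lsum Q (S n) = (lsum Q n * Q + conj (Q ^ n))%quat.
Proof.
induction n as [|n IH]; [simpl; quat_ring|].
change (lsum Q (S (S n))) with (conj Q * lsum Q (S n) + Q ^ S n)%quat.
rewrite IH at 1; simpl lsum; rewrite conj_pow_S; simpl pow_n.
rewrite <- (pow_n_comm_1 Q n).
generalize (lsum Q n), (Q ^ n)%quat; quat_ring.
Qed.

(** The weight k + 1 splits as 1 + k: the ones give [lsum], the rest has a factor [Q]. This is the
    recurrence that the Laplacian satisfies. *)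
Lemma csum_succ (Q : quat) (n : nat) :
  csum Q (S n) = (lsum Q n + Q * csum Q n)%quat.
Proof.
induction n as [|n IH]; [simpl; quat_ring|].
change (csum Q (S (S n))) with
  (conj Q * csum Q (S n) + INR (S n) *: (Q ^ n))%quat.
rewrite IH at 1; simpl lsum; simpl csum; rewrite S_INR.
destruct n as [|n].
- simpl; quat_ring.
- simpl (pred _); simpl pow_n.
  generalize (INR (S n)), (lsum Q (S n)), (csum Q (S n)), (Q ^ n)%quat; quat_ring.
Qed.

(** The derivative is the sum of the products Q^i A Q^(n-1-i), so the last factor may be peeled off
    instead of the first. With [Q] on the right, multiplication by e_i from the left does not
    interfere. *)
Lemma pow_d1_succ_right (Q A : quat) (n : nat) :
  pow_d1 Q A (S n) = (Q ^ n * A + pow_d1 Q A n * Q)%quat.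
Proof.
induction n as [|n IH]; [simpl; quat_ring|].
change (pow_d1 Q A (S (S n))) with (A * Q ^ S n + Q * pow_d1 Q A (S n))%quat.
rewrite IH at 1; simpl pow_d1; simpl pow_n.
rewrite <- (pow_n_comm_1 Q n).
replace (Q * (Q ^ n * A + pow_d1 Q A n * Q))%quat with
  (Q * Q ^ n * A + Q * pow_d1 Q A n * Q)%quat
  by (generalize (pow_d1 Q A n), (Q ^ n)%quat; quat_ring).
rewrite <- (pow_n_comm_1 Q n).
generalize (pow_d1 Q A n), (Q ^ n)%quat; quat_ring.
Qed.

(* With [y = q - p0] one has [Qp p q = y^2 + c], and [quad_d1 y e] is its
   derivative in the direction [e]. *)
Definition quad (y : quat) (c : R) : quat := (y * y + RtoH c)%quat.
Definition quad_d1 (y e : quat) : quat := (y * e + e * y)%quat.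

Lemma quad_pow_comm (y : quat) (c : R) (n : nat) :
  (quad y c ^ n * y = y * quad y c ^ n)%quat.
Proof.
induction n as [|n IH]; [simpl; quat_ring|].
simpl pow_n.
transitivity (quad y c * (quad y c ^ n * y))%quat;
  [symmetry; apply mult_assoc|rewrite IH].
generalize (quad y c ^ n)%quat; unfold quad; quat_ring.
Qed.

(** A real direction commutes with y, so the commutative chain rule holds. At n = 0 the truncated
    [pred] is harmless, its coefficient being 0. *)
Lemma pow_d1_real (y : quat) (c : R) (n : nat) :
  pow_d1 (quad y c) (quad_d1 y e0) n
    = ((2 * INR n) *: (y * quad y c ^ pred n))%quat.
Proof.
induction n as [|n IH]; [simpl; quat_ring|].
simpl pow_d1; rewrite IH, S_INR.
destruct n as [|n]; [simpl; unfold quad_d1; quat_ring|].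
simpl (pred _); simpl pow_n.
generalize (quad y c ^ n)%quat, (INR (S n)); unfold quad, quad_d1; quat_ring.
Qed.

(** By linearity the left side is the derivative in the direction [vec y], which commutes with y. *)
Lemma pow_d1_radial (y : quat) (c : R) (n : nat) :
  let D e := pow_d1 (quad y c) (quad_d1 y e) n in
  (im1 y *: D e1 + im2 y *: D e2 + im3 y *: D e3)%quat
    = ((2 * INR n) *: (vec y * (y * quad y c ^ pred n)))%quat.
Proof.
cbv zeta; induction n as [|n IH]; [simpl; quat_ring|].
simpl pow_d1; rewrite S_INR; revert IH.
generalize (pow_d1 (quad y c) (quad_d1 y e1) n),
  (pow_d1 (quad y c) (quad_d1 y e2) n), (pow_d1 (quad y c) (quad_d1 y e3) n).
intros D1 D2 D3 IH.
transitivity (2 *: (vec y * (y * quad y c ^ n)) +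
  quad y c * (im1 y *: D1 + im2 y *: D2 + im3 y *: D3))%quat.
- generalize (quad y c), (quad y c ^ n)%quat; unfold quad_d1; quat_ring.
- rewrite IH; destruct n as [|n]; [simpl; quat_ring|].
  simpl (pred _); simpl pow_n.
  generalize (quad y c ^ n)%quat, (INR (S n)); unfold quad; quat_ring.
Qed.

(** With Q = [quad y c], applying sum_i e_i x e_i = -2 conj(x) to x = Q^n y and x = Q^n gives -2
    (conj(y) + y) conj(Q^n) = -4 y0 conj(Q^n) in the induction step, because y commutes with Q^n. *)
Lemma pow_d1_fueter_left (y : quat) (c : R) (n : nat) :
  let D e := pow_d1 (quad y c) (quad_d1 y e) n in
  (D e0 + e1 * D e1 + e2 * D e2 + e3 * D e3)%quat
    = ((-4 * re y) *: lsum (quad y c) n)%quat.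
Proof.
cbv zeta; induction n as [|n IH]; [simpl; quat_ring|].
rewrite !pow_d1_succ_right, lsum_succ_right; revert IH.
generalize (pow_d1 (quad y c) (quad_d1 y e0) n),
  (pow_d1 (quad y c) (quad_d1 y e1) n),
  (pow_d1 (quad y c) (quad_d1 y e2) n), (pow_d1 (quad y c) (quad_d1 y e3) n).
intros D0 D1 D2 D3 IH.
(* The commutator is what remains when Q^n is an arbitrary quaternion; it vanishes by
   [quad_pow_comm]. *)
transitivity (2 *: (quad y c ^ n * y - y * quad y c ^ n)
  + (-4 * re y) *: conj (quad y c ^ n)
  + (D0 + e1 * D1 + e2 * D2 + e3 * D3) * quad y c)%quat.
- generalize (quad y c), (quad y c ^ n)%quat; unfold quad_d1; quat_ring.
- rewrite IH, quad_pow_comm.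
  generalize (quad y c), (lsum (quad y c) n), (quad y c ^ n)%quat; quat_ring.
Qed.

Lemma pow_d1_fueter_right (y : quat) (c : R) (n : nat) :
  let D e := pow_d1 (quad y c) (quad_d1 y e) n in
  (D e0 + D e1 * e1 + D e2 * e2 + D e3 * e3)%quat
    = ((-4 * re y) *: lsum (quad y c) n)%quat.
Proof.
cbv zeta; induction n as [|n IH]; [simpl; quat_ring|].
rewrite lsum_succ_left; simpl pow_d1; revert IH.
generalize (pow_d1 (quad y c) (quad_d1 y e0) n),
  (pow_d1 (quad y c) (quad_d1 y e1) n),
  (pow_d1 (quad y c) (quad_d1 y e2) n), (pow_d1 (quad y c) (quad_d1 y e3) n).
intros D0 D1 D2 D3 IH.
transitivity (2 *: (y * quad y c ^ n - quad y c ^ n * y)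
  + (-4 * re y) *: conj (quad y c ^ n)
  + quad y c * (D0 + D1 * e1 + D2 * e2 + D3 * e3))%quat.
- generalize (quad y c), (quad y c ^ n)%quat; unfold quad_d1; quat_ring.
- rewrite IH, quad_pow_comm.
  generalize (quad y c), (lsum (quad y c) n), (quad y c ^ n)%quat; quat_ring.
Qed.

Lemma pow_laplacian (y : quat) (c : R) (n : nat) :
  let E e := pow_d2 (quad y c) (quad_d1 y e) (2 *: (e * e))%quat n in
  (E e0 + E e1 + E e2 + E e3)%quat
    = ((-16 * re y ^ 2) *: csum (quad y c) n
       - (4 * INR n) *: (quad y c ^ pred n))%quat.
Proof.
cbv zeta; induction n as [|n IH]; [simpl; quat_ring|].
rewrite S_INR, csum_succ; simpl pow_d2; revert IH.
assert (H0 := pow_d1_real y c n).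
assert (HW := pow_d1_radial y c n).
assert (HG := pow_d1_fueter_left y c n).
cbv beta zeta in HW, HG; revert H0 HW HG.
generalize (pow_d1 (quad y c) (quad_d1 y e0) n),
  (pow_d1 (quad y c) (quad_d1 y e1) n),
  (pow_d1 (quad y c) (quad_d1 y e2) n), (pow_d1 (quad y c) (quad_d1 y e3) n).
generalize (pow_d2 (quad y c) (quad_d1 y e0) (2 *: (e0 * e0))%quat n),
  (pow_d2 (quad y c) (quad_d1 y e1) (2 *: (e1 * e1))%quat n),
  (pow_d2 (quad y c) (quad_d1 y e2) (2 *: (e2 * e2))%quat n),
  (pow_d2 (quad y c) (quad_d1 y e3) (2 *: (e3 * e3))%quat n).
intros E0 E1 E2 E3 D0 D1 D2 D3 H0 HW HG IH.
(* The accelerations add up to 2 (1 - 1 - 1 - 1) = -4. For i >= 1 one has y e_i + e_i y = 2 y0 e_i -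
   2 y_i, which produces the left Fueter sum. The real and radial contributions cancel, both obeying
   the commutative chain rule, and -16 y0^2 [lsum] is left. *)
transitivity ((-4) *: (quad y c ^ n)
  + 4 *: (y * D0 + re y *: ((D0 + e1 * D1 + e2 * D2 + e3 * D3) - D0)
          - (im1 y *: D1 + im2 y *: D2 + im3 y *: D3))
  + quad y c * (E0 + E1 + E2 + E3))%quat.
- clear; generalize (quad y c), (quad y c ^ n)%quat; unfold quad_d1; quat_ring.
- rewrite IH, HG, HW, H0; clear.
  destruct n as [|n]; [simpl; quat_ring|].
  simpl (pred _); simpl pow_n.
  generalize (quad y c), (lsum (quad y c) (S n)), (csum (quad y c) (S n)),
    (quad y c ^ n)%quat, (INR (S n)); quat_ring.
Qed.

Lemma norm_lsum_le (Q : quat) (rho : R) (n : nat) :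
  norm Q <= rho -> norm (lsum Q (S n)) <= INR (S n) * rho ^ n.
Proof.
intros HQ; induction n as [|n IH].
- simpl lsum; eapply Rle_trans; [apply norm_plus_le|].
  + apply norm_mult_le; [apply Rle_refl|right; apply norm_zero_quat].
  + right; apply norm_one_quat.
  + simpl; lra.
- change (lsum Q (S (S n))) with (conj Q * lsum Q (S n) + Q ^ S n)%quat.
  eapply Rle_trans; [apply norm_plus_le|].
  + apply norm_mult_le; [rewrite norm_conj; exact HQ|exact IH].
  + apply norm_pow_le, HQ.
  + rewrite (S_INR (S n)); simpl pow; lra.
Qed.

Lemma norm_csum_le (Q : quat) (rho : R) (n : nat) :
  norm Q <= rho -> norm (csum Q (S (S n))) <= INR (S n) ^ 2 * rho ^ n.
Proof.
intros HQ.
assert (H0 : 0 <= rho) by (eapply Rle_trans; [apply (norm_ge_0 Q)|exact HQ]).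
induction n as [|n IH].
- replace (csum Q 2) with (one : quat) by (simpl; quat_ring).
  rewrite norm_one_quat; simpl; lra.
- change (csum Q (S (S (S n)))) with
    (conj Q * csum Q (S (S n)) + INR (S (S n)) *: (Q ^ S n))%quat.
  eapply Rle_trans; [apply norm_plus_le|].
  + apply norm_mult_le; [rewrite norm_conj; exact HQ|exact IH].
  + apply norm_scal_le; [rewrite Rabs_pos_eq by apply pos_INR; apply Rle_refl|].
    apply norm_pow_le, HQ.
  + assert (0 <= rho * rho ^ n) by nonneg.
    assert (Hm := pos_INR (S n)); rewrite (S_INR (S n)); clear IH.
    revert Hm; generalize (INR (S n)) as m; intros m Hm.
    assert (0 <= rho * rho ^ n * m) by nonneg.
    simpl pow; lra.
Qed.

(** * Estimates for the terms of the spherical expansion *)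

Lemma Qp_quad (p q : quat) :
  Qp p q = quad (q - RtoH (re p)) (norm p ^ 2 - re p ^ 2).
Proof. unfold Qp; generalize (norm p); unfold quad; quat_ring. Qed.

Lemma Qp_line (p q e : quat) (t : R) :
  Qp p (q + t *: e)%quat =
  (Qp p q + t *: quad_d1 (q - RtoH (re p)) e
   + (t ^ 2 / 2) *: (2 *: (e * e)))%quat.
Proof. unfold Qp; generalize (norm p); unfold quad_d1; quat_ring. Qed.

Lemma quad_d1_line (p q e : quat) (t : R) :
  quad_d1 (q + t *: e - RtoH (re p))%quat e =
  (quad_d1 (q - RtoH (re p)) e + t *: (2 *: (e * e)))%quat.
Proof. unfold quad_d1; quat_ring. Qed.

Lemma norm_quad_d1_le (y e : quat) :
  norm e = 1 -> norm (quad_d1 y e) <= 2 * norm y.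
Proof.
intros He; eapply Rle_trans; [apply norm_plus_le|].
- apply norm_mult_le; [apply Rle_refl|right; exact He].
- apply norm_mult_le; [right; exact He|apply Rle_refl].
- lra.
Qed.

Definition affine_part (a : nat -> quat) (p q : quat) (n : nat) : quat :=
  (a (2 * n)%nat + (q - p) * a (2 * n + 1)%nat)%quat.

Definition term_d1 (a : nat -> quat) (p e q : quat) (n : nat) : quat :=
  (pow_d1 (Qp p q) (quad_d1 (q - RtoH (re p)) e) n * affine_part a p q n
   + Qp p q ^ n * (e * a (2 * n + 1)%nat))%quat.

Definition term_d2 (a : nat -> quat) (p e q : quat) (n : nat) : quat :=
  (pow_d2 (Qp p q) (quad_d1 (q - RtoH (re p)) e) (2 *: (e * e)) n
     * affine_part a p q n
   + 2 *: (pow_d1 (Qp p q) (quad_d1 (q - RtoH (re p)) e) n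
           * (e * a (2 * n + 1)%nat)))%quat.

(** These bounds do not mention a direction: along any unit vector the velocity is at most 2 |q -
    p0|. *)
Definition tame (p : quat) (rho L K : R) (q : quat) : Prop :=
  norm (Qp p q) <= rho /\ 2 * norm (q - RtoH (re p))%quat <= L * rho /\
  norm (q - p)%quat <= K.

Definition coef_norm (a : nat -> quat) (n : nat) : R :=
  norm (a (2 * n)%nat) + norm (a (2 * n + 1)%nat).

(** One sequence dominating both termwise derivatives and, up to the factor t^2, both Taylor
    remainders, so that a single summability statement suffices. *)
Definition term_majorant (a : nat -> quat) (rho L K : R) (n : nat) : R :=
  4 * L ^ 3 * K * ((INR n + 1) ^ 3 * rho ^ n * coef_norm a n).

Lemma coef_norm_ge0 (a : nat -> quat) (n : nat) : 0 <= coef_norm a n.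
Proof. apply Rplus_le_le_0_compat; apply norm_ge_0. Qed.

Lemma norm_affine_part_le (a : nat -> quat) (p q : quat) (K : R) (n : nat) :
  1 <= K -> norm (q - p)%quat <= K ->
  norm (affine_part a p q n) <= K * coef_norm a n.
Proof.
intros HK Hq; eapply Rle_trans; [apply norm_plus_le|].
- apply Rle_refl.
- apply norm_mult_le; [exact Hq|apply Rle_refl].
- unfold coef_norm; generalize (norm_ge_0 (a (2 * n)%nat)); nra.
Qed.

Lemma norm_direction_le (a : nat -> quat) (e : quat) (K : R) (n : nat) :
  1 <= K -> norm e = 1 ->
  norm (e * a (2 * n + 1)%nat)%quat <= K * coef_norm a n.
Proof.
intros HK He; rewrite norm_quat_mult, He; unfold coef_norm.
generalize (norm_ge_0 (a (2 * n)%nat)), (norm_ge_0 (a (2 * n + 1)%nat)); nra.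
Qed.

Lemma norm_acceleration_le (e : quat) (rho L : R) :
  norm e = 1 -> 1 <= L ^ 2 * rho ->
  norm (2 *: (e * e))%quat <= 2 * L ^ 2 * rho.
Proof.
intros He HL; rewrite norm_quat_scal, norm_quat_mult, He, Rabs_pos_eq; lra.
Qed.

Lemma majorant_ge (a : nat -> quat) (rho L K c : R) (n : nat) :
  0 <= rho -> 0 <= L -> 0 <= K ->
  c <= 4 * L ^ 3 * (INR n + 1) ^ 3 ->
  c * (rho ^ n * (K * coef_norm a n)) <= term_majorant a rho L K n.
Proof.
intros Hr HL HK Hc; unfold term_majorant.
replace (4 * L ^ 3 * K * ((INR n + 1) ^ 3 * rho ^ n * coef_norm a n)) with
  (4 * L ^ 3 * (INR n + 1) ^ 3 * (rho ^ n * (K * coef_norm a n))) by ring.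
apply Rmult_le_compat_r; [|exact Hc].
generalize (coef_norm_ge0 a n); intros; nonneg.
Qed.

(** As 1 <= L, all powers of [L] may be raised to the third; coefficients up to 4 then stay below
    the 4, 12, 12, 4 of 4 (x + 1)^3. *)
Lemma cubic_le (L x c1 c2 c3 : R) :
  1 <= L -> 0 <= x ->
  0 <= c1 <= 4 -> 0 <= c2 <= 4 -> 0 <= c3 <= 4 ->
  c3 * x ^ 3 * L ^ 3 + c2 * x ^ 2 * L ^ 2 + c1 * x * L + 1
    <= 4 * L ^ 3 * (x + 1) ^ 3.
Proof.
intros HL Hx H1 H2 H3.
assert (HL2 : 1 <= L ^ 2) by nra.
assert (HL3 : L ^ 2 <= L ^ 3) by (simpl pow; nra).
assert (HL1 : L <= L ^ 3) by (simpl pow in *; nra).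
assert (Hx2 := pow2_ge_0 x).
assert (Hx3 : 0 <= x ^ 3) by (apply pow_le; exact Hx).
assert (c3 * x ^ 3 * L ^ 3 <= 4 * x ^ 3 * L ^ 3).
{ apply Rmult_le_compat_r; [lra|]; apply Rmult_le_compat_r; lra. }
assert (c2 * x ^ 2 * L ^ 2 <= 4 * x ^ 2 * L ^ 3).
{ apply Rmult_le_compat; [nonneg; lra|lra| |lra]; apply Rmult_le_compat_r; lra. }
assert (c1 * x * L <= 4 * x * L ^ 3).
{ apply Rmult_le_compat; [nonneg; lra|lra| |lra]; apply Rmult_le_compat_r; lra. }
assert (0 <= L ^ 3 * x) by (apply Rmult_le_pos; lra).
assert (0 <= L ^ 3 * x ^ 2) by (apply Rmult_le_pos; lra).
replace (4 * L ^ 3 * (x + 1) ^ 3) with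
  (4 * x ^ 3 * L ^ 3 + 12 * (L ^ 3 * x ^ 2) + 12 * (L ^ 3 * x) + 4 * L ^ 3)
  by ring.
lra.
Qed.

Lemma square_le_cubic (L m x : R) :
  1 <= L -> 0 <= m -> m <= x -> m ^ 2 <= 4 * L ^ 3 * (x + 1) ^ 3.
Proof.
intros HL Hm Hx.
apply Rle_trans with (x ^ 2 * L ^ 2).
- rewrite <- (Rmult_1_r (m ^ 2)).
  apply Rmult_le_compat; [apply pow2_ge_0|lra|apply pow_incr; lra|].
  rewrite <- (pow1 2); apply pow_incr; lra.
- generalize (cubic_le L x 0 1 0 HL ltac:(lra)); lra.
Qed.

Lemma linear_le_cubic (L m x : R) :
  1 <= L -> 0 <= m -> m <= x -> m <= 4 * L ^ 3 * (x + 1) ^ 3.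
Proof.
intros HL Hm Hx; assert (x <= x * L) by (rewrite <- Rmult_1_r at 1; nra).
generalize (cubic_le L x 1 0 0 HL ltac:(lra)); lra.
Qed.

Lemma tame_velocity (p q e : quat) (rho L K : R) :
  norm e = 1 -> tame p rho L K q ->
  norm (quad_d1 (q - RtoH (re p)) e) <= L * rho.
Proof.
intros He (_ & Hq & _); eapply Rle_trans; [apply norm_quad_d1_le, He|exact Hq].
Qed.

Lemma norm_term_d1_le (a : nat -> quat) (p e q : quat) (rho L K : R) (n : nat) :
  0 <= rho -> 1 <= L -> 1 <= K -> norm e = 1 -> tame p rho L K q ->
  norm (term_d1 a p e q n) <= term_majorant a rho L K n.
Proof.
intros Hr HL HK He Hq; assert (HA := tame_velocity _ _ _ _ _ _ He Hq).
destruct Hq as (HQ & Hy & Hp).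
eapply Rle_trans; [apply norm_plus_le; apply norm_mult_le|].
- apply norm_pow_d1_le with (L := L) (rho := rho); assumption.
- apply norm_affine_part_le; eassumption.
- apply norm_pow_le; eassumption.
- apply norm_direction_le; eassumption.
- eapply Rle_trans; [|apply (majorant_ge _ _ _ _ (INR n * L + 1)); try lra].
  + right; ring.
  + generalize (cubic_le L (INR n) 1 0 0 HL (pos_INR n)); lra.
Qed.

Lemma norm_term_d2_le (a : nat -> quat) (p e q : quat) (rho L K : R) (n : nat) :
  0 <= rho -> 1 <= L -> 1 <= L ^ 2 * rho -> 1 <= K -> norm e = 1 ->
  tame p rho L K q ->
  norm (term_d2 a p e q n) <= term_majorant a rho L K n.
Proof.
intros Hr HL HL' HK He Hq; assert (HA := tame_velocity _ _ _ _ _ _ He Hq).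
assert (HB := norm_acceleration_le _ _ _ He HL').
assert (HLr : 0 <= L * rho) by (apply Rmult_le_pos; lra).
destruct Hq as (HQ & Hy & Hp).
eapply Rle_trans; [apply norm_plus_le|].
- apply norm_mult_le.
  + apply norm_pow_d2_le with (L := L) (rho := rho); assumption.
  + apply norm_affine_part_le; eassumption.
- apply norm_scal_le; [right; apply Rabs_pos_eq; lra|].
  apply norm_mult_le.
  + apply norm_pow_d1_le with (L := L) (rho := rho); assumption.
  + apply norm_direction_le; eassumption.
- eapply Rle_trans;
   [|apply (majorant_ge _ _ _ _ (2 * INR n ^ 2 * L ^ 2 + 2 * INR n * L)); try lra].
  + right; ring.
  + generalize (cubic_le L (INR n) 2 2 0 HL (pos_INR n)); lra.
Qed.

(** The second factor is affine in t with slope e a_(2n+1), so besides the remainder of Qp^n only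
    the cross term, of order t^2, is left. *)
Lemma term_remainder (a : nat -> quat) (p e q : quat) (t rho L K : R) (n : nat) :
  0 <= rho -> 1 <= L -> 1 <= L ^ 2 * rho -> 1 <= K -> norm e = 1 ->
  tame p rho L K q -> tame p rho L K (q + t *: e)%quat ->
  norm (spherical_term a p (q + t *: e) n - spherical_term a p q n
        - t *: term_d1 a p e q n)%quat <= t ^ 2 * term_majorant a rho L K n.
Proof.
intros Hr HL HL' HK He Hq Hq'.
assert (HA := tame_velocity _ _ _ _ _ _ He Hq).
assert (HA' := tame_velocity _ _ _ _ _ _ He Hq').
assert (HB := norm_acceleration_le _ _ _ He HL').
assert (HLr : 0 <= L * rho) by (apply Rmult_le_pos; lra).
destruct Hq as (HQ & Hy & Hp); destruct Hq' as (HQ' & Hy' & Hp').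
match goal with |- norm ?x <= _ => replace x with
  ((Qp p (q + t *: e) ^ n - Qp p q ^ n
    - t *: pow_d1 (Qp p q) (quad_d1 (q - RtoH (re p)) e) n)
     * affine_part a p (q + t *: e) n
   + t ^ 2 *: (pow_d1 (Qp p q) (quad_d1 (q - RtoH (re p)) e) n
               * (e * a (2 * n + 1)%nat)))%quat end.
2: { unfold spherical_term, term_d1, affine_part.
     generalize (Qp p (q + t *: e)%quat ^ n)%quat, (Qp p q ^ n)%quat,
       (pow_d1 (Qp p q) (quad_d1 (q - RtoH (re p)) e) n),
       (a (2 * n)%nat), (a (2 * n + 1)%nat); clear; quat_ring. }
assert (Ht := pow2_ge_0 t).
eapply Rle_trans; [apply norm_plus_le|].
- apply norm_mult_le.
  + exact (pow_d1_remainder _ _ _ _ _ t rho L n HLr (Qp_line p q e t)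
      (quad_d1_line p q e t) HQ HQ' HA HA' HB).
  + apply norm_affine_part_le; eassumption.
- apply norm_scal_le; [right; apply Rabs_pos_eq; exact Ht|].
  apply norm_mult_le.
  + apply norm_pow_d1_le with (L := L) (rho := rho); assumption.
  + apply norm_direction_le; eassumption.
- eapply Rle_trans; [|apply Rmult_le_compat_l; [exact Ht|];
   apply (majorant_ge _ _ _ _ (INR n ^ 2 * L ^ 2 + INR n * L)); try lra].
  + right; ring.
  + generalize (cubic_le L (INR n) 1 1 0 HL (pos_INR n)); lra.
Qed.

Lemma term_d1_remainder (a : nat -> quat) (p e q : quat) (t rho L K : R)
    (n : nat) :
  0 <= rho -> 1 <= L -> 1 <= L ^ 2 * rho -> 1 <= K -> norm e = 1 ->
  tame p rho L K q -> tame p rho L K (q + t *: e)%quat ->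
  norm (term_d1 a p e (q + t *: e) n - term_d1 a p e q n
        - t *: term_d2 a p e q n)%quat <= t ^ 2 * term_majorant a rho L K n.
Proof.
intros Hr HL HL' HK He Hq Hq'.
assert (HA := tame_velocity _ _ _ _ _ _ He Hq).
assert (HA' := tame_velocity _ _ _ _ _ _ He Hq').
assert (HB := norm_acceleration_le _ _ _ He HL').
assert (HL0 : 0 <= L) by lra.
assert (HLr : 0 <= L * rho) by (apply Rmult_le_pos; lra).
destruct Hq as (HQ & Hy & Hp); destruct Hq' as (HQ' & Hy' & Hp').
set (A := quad_d1 (q - RtoH (re p)) e) in *.
set (A' := quad_d1 (q + t *: e - RtoH (re p))%quat e) in *.
set (C := (2 *: (e * e))%quat) in *.
match goal with |- norm ?x <= _ => replace x with
  ((pow_d1 (Qp p (q + t *: e)) A' n - pow_d1 (Qp p q) A n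
    - t *: pow_d2 (Qp p q) A C n) * affine_part a p (q + t *: e) n
   + t ^ 2 *: (pow_d2 (Qp p q) A C n * (e * a (2 * n + 1)%nat))
   + (Qp p (q + t *: e) ^ n - Qp p q ^ n - t *: pow_d1 (Qp p q) A n)
     * (e * a (2 * n + 1)%nat))%quat end.
2: { unfold term_d1, term_d2, affine_part; fold A A' C.
     generalize (Qp p (q + t *: e)%quat ^ n)%quat, (Qp p q ^ n)%quat,
       (pow_d1 (Qp p q) A n), (pow_d1 (Qp p (q + t *: e)%quat) A' n),
       (pow_d2 (Qp p q) A C n),
       (a (2 * n)%nat), (a (2 * n + 1)%nat); clear; quat_ring. }
assert (Ht := pow2_ge_0 t).
eapply Rle_trans; [apply norm_plus_le; [apply norm_plus_le|]|].
- apply norm_mult_le.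
  + exact (pow_d2_remainder _ _ _ _ _ t rho L n HL0 Hr (Qp_line p q e t)
      (quad_d1_line p q e t) HQ HQ' HA HA' HB).
  + apply norm_affine_part_le; eassumption.
- apply norm_scal_le; [right; apply Rabs_pos_eq; exact Ht|].
  apply norm_mult_le.
  + apply norm_pow_d2_le with (L := L) (rho := rho); assumption.
  + apply norm_direction_le; eassumption.
- apply norm_mult_le.
  + exact (pow_d1_remainder _ _ _ _ _ t rho L n HLr (Qp_line p q e t)
      (quad_d1_line p q e t) HQ HQ' HA HA' HB).
  + apply norm_direction_le; eassumption.
- eapply Rle_trans; [|apply Rmult_le_compat_l; [exact Ht|];
   apply (majorant_ge _ _ _ _ (INR n ^ 3 * L ^ 3 + 3 * INR n ^ 2 * L ^ 2)); try lra].
  + right; ring.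
  + generalize (cubic_le L (INR n) 0 3 1 HL (pos_INR n)); lra.
Qed.

(** Second derivatives of the affine factor vanish; the cross terms are twice the right Fueter sum
    times a_(2n+1), whence the coefficient -8. *)
Lemma sum_term_d2 (a : nat -> quat) (p q : quat) (n : nat) :
  (term_d2 a p e0 q n + term_d2 a p e1 q n + term_d2 a p e2 q n
   + term_d2 a p e3 q n)%quat =
  ((-16 * (re q - re p) ^ 2) *: (csum (Qp p q) n * affine_part a p q n)
   - (8 * (re q - re p)) *: (lsum (Qp p q) n * a (2 * n + 1)%nat)
   - 4 *: (INR n *: (Qp p q ^ pred n * affine_part a p q n)))%quat.
Proof.
unfold term_d2.
assert (HL := pow_laplacian (q - RtoH (re p))%quat (norm p ^ 2 - re p ^ 2) n).
assert (HF := pow_d1_fueter_right (q - RtoH (re p))%quat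
  (norm p ^ 2 - re p ^ 2) n).
cbv beta zeta in HL, HF; rewrite <- Qp_quad in HL, HF; revert HL HF.
replace (re (q - RtoH (re p))%quat) with (re q - re p) by reflexivity.
generalize (re q - re p) as y0.
generalize (quad_d1 (q - RtoH (re p))) as A; intros A y0.
generalize (pow_d2 (Qp p q) (A e0) (2 *: (e0 * e0)) n)%quat as E0,
  (pow_d2 (Qp p q) (A e1) (2 *: (e1 * e1)) n)%quat as E1,
  (pow_d2 (Qp p q) (A e2) (2 *: (e2 * e2)) n)%quat as E2,
  (pow_d2 (Qp p q) (A e3) (2 *: (e3 * e3)) n)%quat as E3,
  (pow_d1 (Qp p q) (A e0) n) as D0, (pow_d1 (Qp p q) (A e1) n) as D1,
  (pow_d1 (Qp p q) (A e2) n) as D2, (pow_d1 (Qp p q) (A e3) n) as D3.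
intros E0 E1 E2 E3 D0 D1 D2 D3 HL HF.
transitivity ((E0 + E1 + E2 + E3) * affine_part a p q n
  + 2 *: ((D0 + D1 * e1 + D2 * e2 + D3 * e3) * a (2 * n + 1)%nat))%quat.
- clear; generalize (affine_part a p q n), (a (2 * n + 1)%nat).
  clear; quat_ring.
- rewrite HL, HF; clear.
  generalize (affine_part a p q n), (a (2 * n + 1)%nat), (csum (Qp p q) n),
    (lsum (Qp p q) n), (Qp p q ^ pred n)%quat, (INR n); clear; quat_ring.
Qed.

(** * Series of quaternions *)

Lemma is_series_norm (u : nat -> quat) (S : quat) :
  is_series u S <->
  (forall eps : posreal,
    eventually (fun n => norm (sum_n u n - S)%quat < eps)).
Proof. exact (filterlim_locally_ball_norm (sum_n u) S). Qed.

Lemma is_series_R_dist (u : nat -> R) (S : R) (eps : posreal) :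
  is_series u S -> eventually (fun n => Rabs (sum_n u n - S) < eps).
Proof. intros H; exact (proj1 (filterlim_locally_ball_norm (sum_n u) S) H eps). Qed.

Lemma sum_n_components (u : nat -> quat) (n : nat) :
  sum_n u n = (sum_n (fun k => re (u k)) n, sum_n (fun k => im1 (u k)) n,
               sum_n (fun k => im2 (u k)) n, sum_n (fun k => im3 (u k)) n).
Proof.
induction n as [|n IH].
- rewrite !sum_O; destruct (u O) as [[[? ?] ?] ?]; reflexivity.
- rewrite !sum_Sn, IH; destruct (u (S n)) as [[[? ?] ?] ?]; reflexivity.
Qed.

Lemma is_series_components (u : nat -> quat) (S : quat) :
  is_series (fun n => re (u n)) (re S) -> is_series (fun n => im1 (u n)) (im1 S) ->
  is_series (fun n => im2 (u n)) (im2 S) -> is_series (fun n => im3 (u n)) (im3 S) ->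
  is_series u S.
Proof.
intros H0 H1 H2 H3; apply is_series_norm; intros eps.
assert (He : 0 < eps / 4) by (generalize (cond_pos eps); lra).
set (eps' := mkposreal _ He).
assert (E0 := is_series_R_dist _ _ eps' H0).
assert (E1 := is_series_R_dist _ _ eps' H1).
assert (E2 := is_series_R_dist _ _ eps' H2).
assert (E3 := is_series_R_dist _ _ eps' H3).
generalize (filter_and _ _ (filter_and _ _ E0 E1) (filter_and _ _ E2 E3)).
apply filter_imp; intros n [[L0 L1] [L2 L3]].
eapply Rle_lt_trans; [apply norm_le_components|].
rewrite sum_n_components; destruct S as [[[s0 s1] s2] s3].
match goal with |- ?x < _ => change x with
  (Rabs (sum_n (fun k => re (u k)) n - s0)
   + Rabs (sum_n (fun k => im1 (u k)) n - s1)
   + Rabs (sum_n (fun k => im2 (u k)) n - s2)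
   + Rabs (sum_n (fun k => im3 (u k)) n - s3)) end.
cbn [re im1 im2 im3 fst snd] in L0, L1, L2, L3; simpl pos in *; lra.
Qed.

(** [Series] is total, so termwise derivatives define functions on all of [quat], as the witness in
    [is_pderiv2] must be. *)
Definition quat_series (u : nat -> quat) : quat :=
  (Series (fun n => re (u n)), Series (fun n => im1 (u n)),
   Series (fun n => im2 (u n)), Series (fun n => im3 (u n))).

Lemma quat_series_correct (u : nat -> quat) (b : nat -> R) :
  (forall n, norm (u n) <= b n) -> ex_series b -> is_series u (quat_series u).
Proof.
intros Hu Hb; apply is_series_components; apply Series_correct;
  apply (ex_series_le (V := R_CompleteNormedModule) _ b); trivial; intros n;
  destruct (components_le_norm (u n)) as (? & ? & ? & ?);
  apply Rle_trans with (norm (u n)); trivial.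
Qed.

Lemma norm_series_le (u : nat -> quat) (b : nat -> R) (S : quat) (m : R) :
  (forall n, norm (u n) <= b n) -> is_series u S -> is_series b m -> norm S <= m.
Proof.
intros Hu HS Hm.
apply (is_lim_seq_le (fun n => norm (sum_n u n)) (sum_n b) (norm S) m).
- intros n; eapply Rle_trans; [apply norm_sum_n_m|].
  apply sum_n_m_le; exact Hu.
- exact (filterlim_comp _ _ _ _ _ _ _ _ HS (filterlim_norm S)).
- exact Hm.
Qed.

Lemma quat_series_unique (u : nat -> quat) (S S' : quat) :
  is_series u S -> is_series u S' -> S = S'.
Proof. exact (filterlim_locally_unique (V := quat_NormedModule) _ S S'). Qed.

Lemma is_series_scal_quat (c : R) (u : nat -> quat) (S : quat) :
  is_series u S -> is_series (fun n => (c *: u n)%quat) (c *: S)%quat.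
Proof. exact (is_series_scal (V := quat_NormedModule) c u S). Qed.

Lemma is_series_plus_quat (u v : nat -> quat) (S T : quat) :
  is_series u S -> is_series v T ->
  is_series (fun n => (u n + v n)%quat) (S + T)%quat.
Proof. exact (is_series_plus (V := quat_NormedModule) u v S T). Qed.

Lemma is_series_minus_quat (u v : nat -> quat) (S T : quat) :
  is_series u S -> is_series v T ->
  is_series (fun n => (u n - v n)%quat) (S - T)%quat.
Proof. exact (is_series_minus (V := quat_NormedModule) u v S T). Qed.

(** * Term-by-term differentiation *)

Lemma is_pderiv_quadratic (e : quat) (f : quat -> quat) (q d : quat) (m delta : R) :
  0 <= m -> 0 < delta ->
  (forall t, Rabs t < delta ->
     norm (f (q + t *: e) - f q - t *: d)%quat <= t ^ 2 * m) ->
  is_pderiv e f q d.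
Proof.
intros Hm Hd Hf; split; [apply is_linear_scal_l|].
intros x Hx eps.
rewrite <- (is_filter_lim_locally_unique 0 x Hx).
(* Adding 1 to [m] keeps the denominator positive when m = 0. *)
assert (He : 0 < Rmin delta (eps / (m + 1))).
{ apply Rmin_glb_lt; [exact Hd|].
  apply Rdiv_lt_0_compat; [apply cond_pos|lra]. }
exists (mkposreal _ He); intros t Ht.
change (Rabs (t - 0) < Rmin delta (eps / (m + 1))) in Ht.
change (norm ((f (q + t *: e) - f (q + 0 *: e)) - (t - 0) *: d)%quat
  <= eps * Rabs (t - 0)).
rewrite Rminus_0_r in Ht |- *.
replace (q + 0 *: e)%quat with q by quat_ring.
apply Rmin_Rgt in Ht; destruct Ht as [Ht1 Ht2].
eapply Rle_trans; [apply Hf; exact Ht1|].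
rewrite <- pow2_abs; assert (H0 := Rabs_pos t).
assert (Rabs t * (m + 1) <= eps).
{ apply Rlt_le, Rmult_lt_reg_r with (/ (m + 1)); [apply Rinv_0_lt_compat; lra|].
  rewrite Rmult_assoc, Rinv_r, Rmult_1_r; [exact Ht2|lra]. }
replace (Rabs t ^ 2 * m) with ((Rabs t * m) * Rabs t) by ring.
apply Rmult_le_compat_r; [exact H0|]; nra.
Qed.

(** Summing the termwise remainders bounds the remainder of the sum by t^2 times the sum of [M];
    this domination takes the place of uniform convergence of the differentiated series. *)
Lemma is_pderiv_series (e : quat) (u v : nat -> quat -> quat) (f g : quat -> quat)
    (M : nat -> R) (q : quat) (delta : R) :
  0 < delta -> ex_series M ->
  (forall t, Rabs t < delta ->
     is_series (fun n => u n (q + t *: e)%quat) (f (q + t *: e)%quat)) ->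
  is_series (fun n => v n q) (g q) ->
  (forall t n, Rabs t < delta ->
     norm (u n (q + t *: e) - u n q - t *: v n q)%quat <= t ^ 2 * M n) ->
  is_pderiv e f q (g q).
Proof.
intros Hd [m Hm] Hu Hv HM.
assert (Hq : is_series (fun n => u n q) (f q)).
{ assert (H0 : Rabs 0 < delta) by (rewrite Rabs_R0; exact Hd).
  generalize (Hu 0 H0); replace (q + 0 *: e)%quat with q by quat_ring; trivial. }
assert (Hbound : forall t, Rabs t < delta ->
  norm (f (q + t *: e) - f q - t *: g q)%quat <= t ^ 2 * m).
{ intros t Ht; apply (norm_series_le _ (fun n => t ^ 2 * M n) _ _
    (fun n => HM t n Ht)).
  - apply is_series_minus_quat;
      [apply is_series_minus_quat; [apply Hu; exact Ht|exact Hq]|].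
    exact (is_series_scal_quat t _ _ Hv).
  - exact (is_series_scal (V := R_NormedModule) (t ^ 2) _ _ Hm). }
apply is_pderiv_quadratic with (Rabs m) delta; [apply Rabs_pos|exact Hd|].
intros t Ht; eapply Rle_trans; [apply Hbound, Ht|].
apply Rmult_le_compat_l; [apply pow2_ge_0|apply Rle_abs].
Qed.

(** * Polynomial factors against geometric growth *)

Lemma linear_geometric_le (x y : R) :
  0 < x < y -> exists C, 0 <= C /\ forall n, (INR n + 1) * x ^ n <= C * y ^ n.
Proof.
intros [Hx Hxy]; set (h := y / x - 1).
assert (Hh : 0 < h).
{ unfold h; assert (1 < y / x); [|lra].
  apply Rmult_lt_reg_r with x; [exact Hx|]; unfold Rdiv.
  rewrite Rmult_assoc, Rinv_l; lra. }
assert (Hy : y = x * (1 + h)) by (unfold h; field; lra).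
(* Bernoulli gives (1 + h)^n >= 1 + n h, and (1 + n h)(1 + 1/h) >= n + 1. *)
exists (1 + / h); split; [generalize (Rinv_0_lt_compat h Hh); lra|]; intros n.
rewrite Hy, Rpow_mult_distr, (Rmult_comm _ (x ^ n)).
rewrite (Rmult_comm (1 + / h)), Rmult_assoc.
apply Rmult_le_compat_l; [apply pow_le; lra|].
generalize (poly n h Hh); intros Hb.
assert (Hn := pos_INR n); assert (Hi := Rinv_0_lt_compat h Hh).
apply Rle_trans with ((1 + INR n * h) * (1 + / h));
  [|apply Rmult_le_compat_r; lra].
replace ((1 + INR n * h) * (1 + / h)) with
  (1 + / h + INR n * h + INR n * (h * / h)) by ring.
rewrite Rinv_r by lra; generalize (Rmult_le_pos _ _ Hn (Rlt_le _ _ Hh)); lra.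
Qed.

(** Each factor n + 1 is paid for by one third of the gap between [x] and [y]. *)
Lemma cubic_geometric_le (x y : R) :
  0 < x < y ->
  exists C, 0 <= C /\ forall n, (INR n + 1) ^ 3 * x ^ n <= C * y ^ n.
Proof.
intros H; set (d := (y - x) / 3).
destruct (linear_geometric_le x (x + d)) as (C1 & P1 & H1); [unfold d; lra|].
destruct (linear_geometric_le (x + d) (x + 2 * d)) as (C2 & P2 & H2);
  [unfold d; lra|].
destruct (linear_geometric_le (x + 2 * d) y) as (C3 & P3 & H3); [unfold d; lra|].
exists (C1 * C2 * C3); split; [nonneg|]; intros n.
assert (Hn := pos_INR n).
replace ((INR n + 1) ^ 3 * x ^ n) with
  ((INR n + 1) * ((INR n + 1) * ((INR n + 1) * x ^ n))) by ring.
apply Rle_trans with ((INR n + 1) * ((INR n + 1) * (C1 * (x + d) ^ n))).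
{ repeat (apply Rmult_le_compat_l; [lra|]); apply H1. }
replace ((INR n + 1) * ((INR n + 1) * (C1 * (x + d) ^ n))) with
  (C1 * ((INR n + 1) * ((INR n + 1) * (x + d) ^ n))) by ring.
rewrite !Rmult_assoc; apply Rmult_le_compat_l; [exact P1|].
apply Rle_trans with ((INR n + 1) * (C2 * (x + 2 * d) ^ n)).
{ apply Rmult_le_compat_l; [lra|]; apply H2. }
replace ((INR n + 1) * (C2 * (x + 2 * d) ^ n)) with
  (C2 * ((INR n + 1) * (x + 2 * d) ^ n)) by ring.
apply Rmult_le_compat_l; [exact P2|]; apply H3.
Qed.

(** * The Laplacian of the spherical expansion *)

Lemma re_pow2_le_norm (p : quat) : re p ^ 2 <= norm p ^ 2.
Proof.
destruct (components_le_norm p) as (H & _).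
rewrite <- pow2_abs; apply pow_incr; split; [apply Rabs_pos|exact H].
Qed.

(* Both points [q = p0 +- w e1] with [w^2 = |vec p|^2 + s] satisfy [Qp p q = -s], so
   absolute convergence at the two of them controls [a_2n] and [a_2n+1]
   separately. *)
Lemma ex_series_coef_norm (a : nat -> quat) (p : quat) (s r : R) :
  0 < s < r ^ 2 ->
  (forall q, cassini_ball p r q ->
     ex_series (fun n => norm (spherical_term a p q n))) ->
  ex_series (fun n => s ^ n * coef_norm a n).
Proof.
intros Hs Ha.
assert (Hp := re_pow2_le_norm p).
(* Positivity of [s] gives w > 0, so the two test points differ even for real [p]. *)
set (w := sqrt (norm p ^ 2 - re p ^ 2 + s)).
assert (Hw : 0 < w) by (apply sqrt_lt_R0; lra).
assert (Hw2 : w * w = norm p ^ 2 - re p ^ 2 + s) by (apply sqrt_sqrt; lra).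
set (q1 := (re p, w, 0, 0) : quat); set (q2 := (re p, - w, 0, 0) : quat).
clearbody w.
assert (HQ : forall v, v * v = norm p ^ 2 - re p ^ 2 + s ->
  norm (Qp p (re p, v, 0, 0)) = s).
{ intros v Hv; replace (Qp p (re p, v, 0, 0)) with ((- s) *: (one : quat))%quat.
  - rewrite norm_quat_scal, norm_one_quat, Rabs_Ropp, Rabs_pos_eq; lra.
  - replace s with (v * v - norm p ^ 2 + re p ^ 2) by lra.
    rewrite Qp_quad; generalize (norm p); clear; unfold quad; quat_ring. }
assert (HQ1 : norm (Qp p q1) = s) by (apply HQ; lra).
assert (HQ2 : norm (Qp p q2) = s) by (apply HQ; lra).
assert (HT1 : ex_series (fun n => norm (spherical_term a p q1 n)))
  by (apply Ha; unfold cassini_ball; lra).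
assert (HT2 : ex_series (fun n => norm (spherical_term a p q2 n)))
  by (apply Ha; unfold cassini_ball; lra).
(* With affine factors g1, g2 at the two points and coefficients u, v, subtraction gives |v| <=
   (|g1| + |g2|) / (2 w), and |u| <= |g1| + k |v|; adding the two yields this constant. *)
set (k := norm (q1 - p)%quat); set (c := 1 + (1 + k) / (2 * w)).
apply (ex_series_le (V := R_CompleteNormedModule) _ (fun n =>
  c * (norm (spherical_term a p q1 n) + norm (spherical_term a p q2 n)))).
2: { exact (ex_series_scal (V := R_NormedModule) c _
       (ex_series_plus (V := R_NormedModule) _ _ HT1 HT2)). }
intros n; change (Rabs (s ^ n * coef_norm a n) <=
  c * (norm (spherical_term a p q1 n) + norm (spherical_term a p q2 n))).
assert (Hsn : 0 <= s ^ n) by (apply pow_le; lra).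
rewrite Rabs_pos_eq by (apply Rmult_le_pos; [exact Hsn|apply coef_norm_ge0]).
unfold spherical_term; rewrite !norm_quat_mult, !norm_pow_quat, HQ1, HQ2.
rewrite <- Rmult_plus_distr_l, <- Rmult_assoc, (Rmult_comm c), Rmult_assoc.
apply Rmult_le_compat_l; [exact Hsn|]; unfold coef_norm.
generalize (a (2 * n)%nat) as u, (a (2 * n + 1)%nat) as v; intros u v.
set (g1 := (u + (q1 - p) * v)%quat); set (g2 := (u + (q2 - p) * v)%quat).
assert (Hk : 0 <= k) by apply (norm_ge_0 (q1 - p)%quat).
assert (Hg1 := norm_ge_0 g1); assert (Hg2 := norm_ge_0 g2).
assert (Hv : norm v * (2 * w) <= norm g1 + norm g2).
{ replace (norm v * (2 * w)) with (norm ((2 * w) *: (e1 * v))%quat).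
  - replace ((2 * w) *: (e1 * v))%quat with (g1 + (- g2))%quat.
    + apply norm_plus_le; [apply Rle_refl|right; apply norm_quat_opp].
    + unfold g1, g2, q1, q2; clear; quat_ring.
  - rewrite norm_quat_scal, norm_quat_mult, Rabs_pos_eq by lra.
    replace (norm e1) with 1; [ring|].
    rewrite norm_quat, <- sqrt_1; f_equal; cbn; ring. }
assert (Hu : norm u <= norm g1 + k * norm v).
{ replace u with (g1 + (- ((q1 - p) * v)))%quat at 1
    by (unfold g1; generalize (q1 - p)%quat; clear; quat_ring).
  apply norm_plus_le; [apply Rle_refl|].
  right; rewrite norm_quat_opp; apply norm_quat_mult. }
assert (Hv' : norm v <= (norm g1 + norm g2) / (2 * w)).
{ apply Rmult_le_reg_r with (2 * w); [lra|].
  unfold Rdiv; rewrite Rmult_assoc, Rinv_l; lra. }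
assert ((1 + k) * norm v <= (1 + k) * ((norm g1 + norm g2) / (2 * w)))
  by (apply Rmult_le_compat_l; lra).
unfold c; replace ((1 + (1 + k) / (2 * w)) * (norm g1 + norm g2)) with
  (norm g1 + norm g2 + (1 + k) * ((norm g1 + norm g2) / (2 * w)))
  by (field; lra).
lra.
Qed.

Lemma compact_singleton (x : quat) : compact_set (fun y => y = x).
Proof.
intros J O _ Hcov; destruct (Hcov x eq_refl) as [j Hj].
exists (j :: nil); intros y ->; exists j; split; [left; reflexivity|exact Hj].
Qed.

Lemma expansion_on_is_series (U : quat -> Prop) (f : quat -> quat)
    (u : quat -> nat -> quat) (q : quat) :
  expansion_on U f u -> U q -> is_series (u q) (f q).
Proof.
intros [_ Hu] Hq; apply is_series_norm; intros eps.
generalize (Hu _ (compact_singleton q) (fun y Hy => eq_ind_r U Hq Hy) eps).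
apply filter_imp; intros n Hn; apply Hn; reflexivity.
Qed.

Lemma ex_series_majorant (a : nat -> quat) (rho s L K : R) :
  0 < rho < s -> 0 <= L -> 0 <= K ->
  ex_series (fun n => s ^ n * coef_norm a n) ->
  ex_series (term_majorant a rho L K).
Proof.
intros Hr HL HK Hs; destruct (cubic_geometric_le rho s Hr) as (C & HC & Hg).
apply (ex_series_le (V := R_CompleteNormedModule) _
  (fun n => 4 * L ^ 3 * K * C * (s ^ n * coef_norm a n))).
2: exact (ex_series_scal (V := R_NormedModule) _ _ Hs).
intros n; change (Rabs (term_majorant a rho L K n) <=
  4 * L ^ 3 * K * C * (s ^ n * coef_norm a n)).
assert (Hc := coef_norm_ge0 a n); assert (Hn := pos_INR n).
assert (HLK : 0 <= 4 * L ^ 3 * K) by (nonneg; lra).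
assert (H0 : 0 <= (INR n + 1) ^ 3 * rho ^ n)
  by (apply Rmult_le_pos; apply pow_le; lra).
unfold term_majorant; rewrite Rabs_pos_eq by nonneg.
rewrite (Rmult_assoc _ C), <- (Rmult_assoc C).
apply Rmult_le_compat_l; [exact HLK|]; apply Rmult_le_compat_r; [exact Hc|].
apply Hg.
Qed.

Lemma tame_neighborhood (p q : quat) (rho : R) :
  norm (Qp p q) < rho ->
  exists L K delta, 1 <= L /\ 1 <= L ^ 2 * rho /\ 1 <= K /\ 0 < delta /\
    forall x : quat, norm (x - q)%quat < delta -> tame p rho L K x.
Proof.
intros Hrho.
assert (Hr : 0 < rho) by (generalize (norm_ge_0 (Qp p q)); lra).
set (y := (q - RtoH (re p))%quat); set (Y := norm y + 1).
assert (HY : 1 <= Y) by (unfold Y; generalize (norm_ge_0 y); lra).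
(* Then L rho = rho + 1 + 2 Y exceeds 1, whence L^2 rho >= 1, and exceeds 2 |x - p0| whenever |x -
   q| < 1. *)
set (L := 1 + (1 + 2 * Y) / rho).
assert (HLr : L * rho = rho + 1 + 2 * Y) by (unfold L; field; lra).
assert (HL : 1 <= L).
{ unfold L; assert (0 <= (1 + 2 * Y) / rho); [|lra].
  apply Rmult_le_pos; [lra|apply Rlt_le, Rinv_0_lt_compat, Hr]. }
(* For h = x - q the change of [Qp] is y h + h y + h^2, of norm at most |h| (2 |y| + |h|) <= 2 Y |h|
   once |h| <= 1. *)
set (delta := Rmin 1 ((rho - norm (Qp p q)) / (2 * Y))).
assert (Hd : 0 < delta).
{ apply Rmin_glb_lt; [lra|apply Rdiv_lt_0_compat; lra]. }
exists L, (norm (q - p)%quat + 1), delta.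
split; [exact HL|]; split; [simpl; rewrite Rmult_1_r, Rmult_assoc, HLr; nra|].
split; [generalize (norm_ge_0 (q - p)%quat); lra|]; split; [exact Hd|].
intros x Hx; set (h := (x - q)%quat) in *.
apply Rmin_Rgt in Hx; destruct Hx as [Hx1 Hx2].
assert (Hh := norm_ge_0 h).
assert (HhY : norm h * (2 * Y) < rho - norm (Qp p q)).
{ apply Rmult_lt_reg_r with (/ (2 * Y)); [apply Rinv_0_lt_compat; lra|].
  rewrite Rmult_assoc, Rinv_r by lra; rewrite Rmult_1_r; exact Hx2. }
repeat split.
- replace (Qp p x) with (Qp p q + (y * h + h * y + h * h))%quat.
  2: { unfold Qp, h, y; generalize (norm p) as N; clear; quat_ring. }
  eapply Rle_trans; [apply norm_plus_le; [apply Rle_refl|]|].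
  + apply norm_plus_le; [apply norm_plus_le|]; right; apply norm_quat_mult.
  + unfold Y in *; nra.
- rewrite HLr.
  replace (x - RtoH (re p))%quat with (y + h)%quat
    by (unfold y, h; clear; quat_ring).
  assert (norm (y + h)%quat <= norm y + 1) by (apply norm_plus_le; lra).
  unfold Y in *; lra.
- replace (x - p)%quat with ((q - p) + h)%quat
    by (unfold h; clear; quat_ring).
  apply norm_plus_le; lra.
Qed.

(** One majorant valid on a ball serves both differentiations: the first at every point of the ball,
    with the distance to its boundary as admissible range of t, the second at the centre only. *)
Lemma is_pderiv2_spherical (a : nat -> quat) (p q e : quat) (f : quat -> quat)
    (rho L K delta : R) :
  0 <= rho -> 1 <= L -> 1 <= L ^ 2 * rho -> 1 <= K -> norm e = 1 -> 0 < delta ->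
  ex_series (term_majorant a rho L K) ->
  (forall x : quat, norm (x - q)%quat < delta ->
     tame p rho L K x /\ is_series (spherical_term a p x) (f x)) ->
  is_pderiv2 e f q (quat_series (term_d2 a p e q)).
Proof.
intros Hr HL HLr HK He Hd HM Hf.
assert (Hline : forall (x : quat) (t : R), Rabs t < delta - norm (x - q)%quat ->
  norm (x + t *: e - q)%quat < delta).
{ intros x t Ht.
  replace (x + t *: e - q)%quat with ((x - q) + t *: e)%quat
    by (clear; quat_ring).
  eapply Rle_lt_trans;
    [apply norm_plus_le; [apply Rle_refl|right; apply norm_quat_scal]|].
  rewrite He; lra. }
assert (Hq : norm (q - q)%quat = 0)
  by (replace (q - q)%quat with (zero : quat) by quat_ring; apply norm_zero_quat).
exists (fun x => quat_series (term_d1 a p e x)); split.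
- apply (locally_le_locally_norm (V := quat_NormedModule) q).
  exists (mkposreal _ Hd); intros x Hx.
  change (norm (x - q)%quat < delta) in Hx.
  apply (is_pderiv_series e (fun n x => spherical_term a p x n)
    (fun n x => term_d1 a p e x n) f (fun x => quat_series (term_d1 a p e x))
    (term_majorant a rho L K) x (delta - norm (x - q)%quat)); trivial; [lra| | |].
  + intros t Ht; apply Hf, Hline, Ht.
  + apply quat_series_correct with (2 := HM); intros n.
    apply norm_term_d1_le; trivial; apply Hf, Hx.
  + intros t n Ht; apply term_remainder; trivial; apply Hf; [exact Hx|].
    apply Hline, Ht.
- apply (is_pderiv_series e (fun n x => term_d1 a p e x n)
    (fun n x => term_d2 a p e x n) _ (fun x => quat_series (term_d2 a p e x))
    (term_majorant a rho L K) q delta); trivial.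
  + intros t Ht; apply quat_series_correct with (2 := HM); intros n.
    apply norm_term_d1_le; trivial; apply Hf, Hline; lra.
  + apply quat_series_correct with (2 := HM); intros n.
    apply norm_term_d2_le; trivial; apply Hf; lra.
  + intros t n Ht; apply term_d1_remainder; trivial; apply Hf;
      [lra|apply Hline; lra].
Qed.

Lemma is_series_shift (u : nat -> quat) (S : quat) :
  u O = zero -> is_series (fun n => u (Datatypes.S n)) S -> is_series u S.
Proof.
intros H0 HS; apply (is_series_decr_1 (V := quat_NormedModule)).
rewrite H0; match goal with |- is_series _ ?x => replace x with S end;
  [exact HS|clear; quat_ring].
Qed.

Lemma norm_unit_directions :
  norm e0 = 1 /\ norm e1 = 1 /\ norm e2 = 1 /\ norm e3 = 1.
Proof.
repeat split; rewrite norm_quat, <- sqrt_1; f_equal; cbn; ring.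
Qed.

Lemma ex_series_shifted_majorant (M : nat -> R) (c : R) (k : nat) :
  ex_series M -> ex_series (fun n => c * M (n + k)%nat).
Proof.
intros HM; apply (ex_series_scal (V := R_NormedModule) c).
apply (ex_series_ext (fun n => M (k + n)%nat)).
- intros n; rewrite Nat.add_comm; reflexivity.
- apply ex_series_incr_n; exact HM.
Qed.

Theorem theorem7p18 (p : quat) (r : R) (Omega : quat -> Prop)
    (f : quat -> quat) (a : nat -> quat) :
  0 < r ->
  open Omega ->
  axially_symmetric Omega ->
  Omega p ->
  (forall q, cassini_ball p r q -> Omega q) ->
  left_slice_hyperholomorphic Omega f ->
  expansion_on (cassini_ball p r) f (spherical_term a p) ->
  forall q, cassini_ball p r q ->
  exists S1 S2 S3 : quat,
    is_series (fun n => cal_C (n + 2) q p *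
      (a (2 * n + 4)%nat + (q - p) * a (2 * n + 5)%nat))%quat S1 /\
    is_series (fun n => cal_L (n + 1) q p * a (2 * n + 3)%nat)%quat S2 /\
    is_series (fun n => INR (n + 1) *: (Qp p q ^ n *
      (a (2 * n + 2)%nat + (q - p) * a (2 * n + 3)%nat)))%quat S3 /\
    is_laplacian f q
      ((-16 * (re q - re p) ^ 2) *: S1 - (8 * (re q - re p)) *: S2
       - 4 *: S3)%quat.
Proof.
intros _ _ _ _ _ _ Hf q Hq.
unfold cassini_ball in Hq; assert (HQ0 := norm_ge_0 (Qp p q)).
(* A third of the gap makes all three inequalities strict and keeps [rho] positive when [Qp]
   vanishes at [q]; divisions by [rho] follow. *)
set (d := (r ^ 2 - norm (Qp p q)) / 3).
set (rho := norm (Qp p q) + d); set (s := norm (Qp p q) + 2 * d).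
assert (Hrho : 0 < rho < s /\ s < r ^ 2 /\ norm (Qp p q) < rho)
  by (unfold rho, s, d; lra).
destruct Hrho as (Hrs & Hsr & HQ).
destruct (tame_neighborhood p q rho HQ)
  as (L & K & delta & HL & HLr & HK & Hd & Htame).
assert (HM : ex_series (term_majorant a rho L K)).
{ apply ex_series_majorant with s; try lra.
  apply ex_series_coef_norm with p r; [lra|exact (proj1 Hf)]. }
assert (Hnear : forall x : quat, norm (x - q)%quat < delta ->
  tame p rho L K x /\ is_series (spherical_term a p x) (f x)).
{ intros x Hx; split; [apply Htame, Hx|].
  apply (expansion_on_is_series _ _ _ _ Hf).
  destruct (Htame x Hx) as (H & _); unfold cassini_ball; lra. }
assert (Hq0 : norm (q - q)%quat < delta).
{ replace (q - q)%quat with (zero : quat) by (clear; quat_ring).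
  rewrite norm_zero_quat; exact Hd. }
destruct (Htame q Hq0) as (Hle & _ & Hqp).
set (T1 := fun n => (csum (Qp p q) n * affine_part a p q n)%quat).
set (T2 := fun n => (lsum (Qp p q) n * a (2 * n + 1)%nat)%quat).
set (T3 := fun n =>
  (INR n *: (Qp p q ^ pred n * affine_part a p q n))%quat).
assert (Hr0 : 0 <= rho) by lra.
assert (H1 : is_series (fun n => T1 (n + 2)%nat)
  (quat_series (fun n => T1 (n + 2)%nat))).
{ apply quat_series_correct with
    (2 := ex_series_shifted_majorant _ (/ rho ^ 2) 2 HM).
  intros n; rewrite Nat.add_comm; change (2 + n)%nat with (S (S n)); unfold T1.
  eapply Rle_trans; [apply norm_mult_le;
    [apply norm_csum_le; exact Hle|apply norm_affine_part_le; eassumption]|].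
  (* [csum] at n + 2 has degree n in [Qp], while the majorant at n + 2 carries rho^(n+2). *)
  apply Rle_trans with (/ rho ^ 2 * (INR (S n) ^ 2 *
    (rho ^ S (S n) * (K * coef_norm a (S (S n)))))).
  - right; simpl pow; field; lra.
  - apply Rmult_le_compat_l; [apply Rlt_le, Rinv_0_lt_compat, pow_lt; lra|].
    apply majorant_ge; try lra.
    apply square_le_cubic; [exact HL|apply pos_INR|apply le_INR; lia]. }
assert (H2 : is_series (fun n => T2 (n + 1)%nat)
  (quat_series (fun n => T2 (n + 1)%nat))).
{ apply quat_series_correct with
    (2 := ex_series_shifted_majorant _ (/ rho) 1 HM).
  intros n; rewrite Nat.add_comm; change (1 + n)%nat with (S n); unfold T2.
  eapply Rle_trans; [apply norm_mult_le; [apply norm_lsum_le; exact Hle|]|].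
  (* A factor [e0] of norm one is inserted to give the coefficient the form e a_(2n+1). *)
  - rewrite <- (Rmult_1_l (norm _)), <- (proj1 norm_unit_directions),
      <- norm_quat_mult.
    apply norm_direction_le; [exact HK|apply norm_unit_directions].
  - apply Rle_trans with (/ rho * (INR (S n) *
      (rho ^ S n * (K * coef_norm a (S n))))).
    + right; simpl pow; field; lra.
    + apply Rmult_le_compat_l; [apply Rlt_le, Rinv_0_lt_compat; lra|].
      apply majorant_ge; try lra.
      apply linear_le_cubic; [exact HL|apply pos_INR|apply Rle_refl]. }
assert (H3 : is_series (fun n => T3 (n + 1)%nat)
  (quat_series (fun n => T3 (n + 1)%nat))).
{ apply quat_series_correct with
    (2 := ex_series_shifted_majorant _ (/ rho) 1 HM).
  intros n; rewrite Nat.add_comm; change (1 + n)%nat with (S n); unfold T3.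
  eapply Rle_trans; [apply norm_scal_le; [right; apply Rabs_pos_eq, pos_INR|];
    apply norm_mult_le; [apply norm_pow_le; exact Hle
      |apply norm_affine_part_le; eassumption]|].
  apply Rle_trans with (/ rho * (INR (S n) *
    (rho ^ S n * (K * coef_norm a (S n))))).
  - right; simpl pow; simpl pred; field; lra.
  - apply Rmult_le_compat_l; [apply Rlt_le, Rinv_0_lt_compat; lra|].
    apply majorant_ge; try lra.
    apply linear_le_cubic; [exact HL|apply pos_INR|apply Rle_refl]. }
(* [csum] vanishes at 0 and 1, [lsum] and the factor n at 0. Hence the indices of the stated sums
   start at 2, 1 and 1, and prepending the zero terms aligns all three series with that of the
   second derivatives. *)
assert (H1' : is_series T1 (quat_series (fun n => T1 (n + 2)%nat))).
{ apply is_series_shift;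
    [unfold T1; simpl csum; generalize (affine_part a p q 0); clear; quat_ring|].
  apply is_series_shift;
    [unfold T1; simpl csum; generalize (affine_part a p q 1), (Qp p q); clear;
     quat_ring|].
  apply is_series_ext with (2 := H1); intros n; f_equal; lia. }
assert (H2' : is_series T2 (quat_series (fun n => T2 (n + 1)%nat))).
{ apply is_series_shift;
    [unfold T2; simpl lsum; generalize (a (2 * 0 + 1)%nat); clear; quat_ring|].
  apply is_series_ext with (2 := H2); intros n; f_equal; lia. }
assert (H3' : is_series T3 (quat_series (fun n => T3 (n + 1)%nat))).
{ apply is_series_shift;
    [unfold T3; simpl INR; simpl pow_n; generalize (affine_part a p q 0); clear;
     quat_ring|].
  apply is_series_ext with (2 := H3); intros n; f_equal; lia. }
exists (quat_series (fun n => T1 (n + 2)%nat)),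
  (quat_series (fun n => T2 (n + 1)%nat)),
  (quat_series (fun n => T3 (n + 1)%nat)).
split; [|split; [|split]].
- apply is_series_ext with (2 := H1); intros n; unfold T1, affine_part.
  replace (2 * n + 5)%nat with (2 * (n + 2) + 1)%nat by lia.
  replace (2 * n + 4)%nat with (2 * (n + 2))%nat by lia.
  rewrite cal_C_csum; reflexivity.
- apply is_series_ext with (2 := H2); intros n; unfold T2.
  replace (2 * n + 3)%nat with (2 * (n + 1) + 1)%nat by lia.
  rewrite cal_L_lsum; reflexivity.
- apply is_series_ext with (2 := H3); intros n; unfold T3, affine_part.
  replace (2 * n + 3)%nat with (2 * (n + 1) + 1)%nat by lia.
  replace (2 * n + 2)%nat with (2 * (n + 1))%nat by lia.
  rewrite Nat.add_1_r; reflexivity.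
- destruct norm_unit_directions as (N0 & N1 & N2 & N3).
  assert (Hpd : forall e, norm e = 1 ->
    is_pderiv2 e f q (quat_series (term_d2 a p e q))).
  { intros e He; exact (is_pderiv2_spherical a p q e f rho L K delta
      Hr0 HL HLr HK He Hd HM Hnear). }
  assert (Hs : forall e, norm e = 1 ->
    is_series (term_d2 a p e q) (quat_series (term_d2 a p e q))).
  { intros e He; apply quat_series_correct with (2 := HM); intros n.
    apply norm_term_d2_le; trivial; apply Htame, Hq0. }
  exists (quat_series (term_d2 a p e0 q)), (quat_series (term_d2 a p e1 q)),
    (quat_series (term_d2 a p e2 q)), (quat_series (term_d2 a p e3 q)).
  repeat (split; [apply Hpd; assumption|]).
  (* Both sides are sums of this one series, on the derivative side by [sum_term_d2] applied to each
     term. *)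
  apply quat_series_unique with (fun n => ((-16 * (re q - re p) ^ 2) *: T1 n
    - (8 * (re q - re p)) *: T2 n - 4 *: T3 n)%quat).
  + exact (is_series_minus_quat _ _ _ _
      (is_series_minus_quat _ _ _ _ (is_series_scal_quat _ _ _ H1')
         (is_series_scal_quat _ _ _ H2'))
      (is_series_scal_quat _ _ _ H3')).
  + apply is_series_ext with (1 := fun n => sum_term_d2 a p q n).
    exact (is_series_plus_quat _ _ _ _ (is_series_plus_quat _ _ _ _
      (is_series_plus_quat _ _ _ _ (Hs e0 N0) (Hs e1 N1)) (Hs e2 N2)) (Hs e3 N3)).
Qed.
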